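(* Let $C\subset\mathbb R^3$ be a closed strictly convex cone with vertex at the origin. If $C$ is not a set of measure zero, if $C$ has connected exterior, and if $C\subseteq C_{\vartheta_0}$, then $C$ is an admissible source cone.
   Context: For $\gamma\in(0,\pi/2)$, $C_\gamma=\{x\in\mathbb R^3:\ |x'|\le x_3\tan\gamma\}$, $x'=(x_1,x_2)$, is the closed strictly convex circular cone of half-angle $\gamma$. The magic angle $\vartheta_0\in(0,\pi/2)$ is defined by $\cos\vartheta_0=1/\sqrt3$. A cone is strictly convex if it is convex and contains no full line. **Admissible source cone.** A closed cone $C\subset\mathbb R^3$ with vertex at the origin which is contained in some closed strictly convex circular cone (half-opening angle $<\pi/2$), whose exterior is connected, and for which $\int_{\mathbb S^2\cap C}Y_2^m\,dS\ne0$ for some $m\in\{-2,-1,0,1,2\}$. Here, in spherical coordinates $x=(\sin\vartheta\cos\varphi,\sin\vartheta\sin\varphi,\cos\vartheta)$, $$Y_N^m(\varphi,\vartheta)=(-1)^m\sqrt{\tfrac{2N+1}{4\pi}\tfrac{(N-m)!}{(N+m)!}}\;e^{im\varphi}P_N^m(\cos\vartheta),$$ where, with $P_N$ the Legendre polynomials, $P_N^m(x)=(-1)^m(1-x^2)^{m/2}\partial_x^mP_N(x)$ and $P_N^{-m}=(-1)^m\frac{(N-m)!}{(N+m)!}P_N^m$ for $m=0,\dots,N$. *)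

(* Defs.v *)
From HB Require Import structures.
From mathcomp Require Import all_boot all_order all_algebra.
From mathcomp Require Import all_classical all_reals all_analysis.
From mathcomp Require Import complex.

Set Implicit Arguments.
Unset Strict Implicit.
Unset Printing Implicit Defensive.

Import Order.TTheory GRing.Theory Num.Theory.
Import numFieldNormedType.Exports.

Local Open Scope classical_set_scope.
Local Open Scope ring_scope.
Local Open Scope complex_scope.

(* R^3 as a product, so that the product topology, the vector space structure
   and the product Lebesgue measure all apply.  The norm of this product type
   is the sup norm; the Euclidean norm is [enorm]. *)
Notation "''R3[' R ]" := (R * R * R)%type (format "''R3[' R ]").

Section Cones.
Context {R : realType}.
Implicit Types (x a v : 'R3[R]) (C K : set 'R3[R]) (gamma : R).

Definition dot x v : R := x.1.1 * v.1.1 + x.1.2 * v.1.2 + x.2 * v.2.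

Definition enorm x : R := Num.sqrt (dot x x).

Definition vol3 : set (measurableTypeR R * measurableTypeR R * measurableTypeR R)
    -> \bar R :=
  (lebesgue_measure \x lebesgue_measure \x lebesgue_measure)%E.

(* A cone with vertex at the origin; a nonempty one contains the vertex. *)
Definition is_cone C : Prop := forall t x, 0 <= t -> C x -> C (t *: x).

Definition contains_line C : Prop :=
  exists p v, v != 0 /\ forall t : R, C (p + t *: v).

Definition strictly_convex_cone C : Prop :=
  [/\ is_cone C, convex_set C & ~ contains_line C].

Definition cone_gamma gamma : set 'R3[R] :=
  [set x | Num.sqrt (x.1.1 ^+ 2 + x.1.2 ^+ 2) <= x.2 * tan gamma].

(* The circular cone with unit axis [a]; [cone_gamma] is the case of the third
   coordinate axis, see [circular_cone_e3]. *)
Definition circular_cone a gamma : set 'R3[R] :=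
  [set x | enorm (x - dot x a *: a) <= dot x a * tan gamma].

Definition strictly_convex_circular_cone K : Prop :=
  exists a gamma, [/\ enorm a = 1, 0 < gamma < pi / 2 & K = circular_cone a gamma].

Definition connected_exterior C : Prop := connected (~` C).

Definition magic_angle : R := acos (Num.sqrt 3)^-1.

Lemma circular_cone_e3 gamma : circular_cone (0, 0, 1) gamma = cone_gamma gamma.
Proof.
have dotE x : dot x (0, 0, 1) = x.2 by rewrite /dot /= !mulr0 !add0r mulr1.
have subE x : x - x.2 *: ((0, 0, 1) : 'R3[R]) = (x.1.1, x.1.2, 0).
  case: x => -[x1 x2] x3.
  by congr (_, _, _) => /=; rewrite /GRing.scale /= ?mulr0 ?mulr1 ?subr0 ?subrr.
rewrite /circular_cone /cone_gamma; apply: eq_set => x.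
by rewrite dotE subE /enorm /dot /= mulr0 addr0 -!expr2.
Qed.

Lemma magic_angleP :
  0 < magic_angle < pi / 2 /\ cos magic_angle = (Num.sqrt 3)^-1.
Proof.
have s1 : 1 < Num.sqrt (3 : R) by rewrite -[ltLHS]sqrtr1 ltr_sqrt ?ltr1n ?ltr0n.
have i0 : 0 < (Num.sqrt (3 : R))^-1 by rewrite invr_gt0 (lt_trans ltr01).
have i1 : (Num.sqrt (3 : R))^-1 < 1 by rewrite invf_lt1 // (lt_trans ltr01).
have iN : -1 <= (Num.sqrt (3 : R))^-1 by rewrite (le_trans _ (ltW i0)) ?lerN10.
have cE : cos magic_angle = (Num.sqrt 3)^-1.
  by apply: acosK; rewrite in_itv /= iN ltW.
have mI : magic_angle \in `[0, pi].
  by rewrite in_itv /= acos_ge0 ?acos_lepi ?iN ?(ltW i1).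
have pI : pi / 2 \in `[0, (pi : R)].
  by rewrite in_itv /= divr_ge0 ?pi_ge0 // ler_pdivrMr // ler_peMr ?pi_ge0 ?ler1n.
by split=> //; rewrite acos_gt0 ?iN //= -ltr_cos // cE cos_pihalf.
Qed.

End Cones.

Section SphericalHarmonics.
Context {R : realType}.
Implicit Types (N : nat) (m : int) (phi theta x : R).

(* Rodrigues' formula. *)
Definition legendre N : {poly R} :=
  ((2 ^ N * N`!)%N%:R)^-1 *: (('X^2 - 1) ^+ N)^`(N).

Definition assoc_legendre_nat N (k : nat) x : R :=
  (-1) ^+ k * Num.sqrt (1 - x ^+ 2) ^+ k * (legendre N)^`(k).[x].

(* Meaningful for |m| <= N only; [Negz k] is the integer -(k+1). *)
Definition assoc_legendre N m x : R :=
  match m with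
  | Posz k => assoc_legendre_nat N k x
  | Negz k => (-1) ^+ k.+1 * ((N - k.+1)%N`!%:R / (N + k.+1)%N`!%:R)
              * assoc_legendre_nat N k.+1 x
  end.

Definition expi x : R[i] := cos x +i* sin x.

Definition spherical_harmonic N m phi theta : R[i] :=
  ((-1) ^ m * Num.sqrt ((2 * N + 1)%N%:R / (4 * pi)
                        * ((absz (N%:Z - m))`!%:R / (absz (N%:Z + m))`!%:R)))%:C
  * expi (m%:~R * phi) * (assoc_legendre N m (cos theta))%:C.

Definition unit_sphere : set 'R3[R] := [set x | enorm x = 1].

Definition spherical_coord phi theta : 'R3[R] :=
  (sin theta * cos phi, sin theta * sin phi, cos theta).

Definition sphere_chart (A : set 'R3[R]) : set (measurableTypeR R * measurableTypeR R) :=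
  [set p | [/\ 0 <= p.1 <= 2 * pi, 0 <= p.2 <= pi & A (spherical_coord p.1 p.2)]].

(* The integral over A, a subset of the unit sphere, of a function given in
   spherical coordinates, with respect to the surface measure
   dS = sin theta dphi dtheta; real and imaginary parts are integrated
   separately. *)
Definition sphere_integral (A : set 'R3[R]) (f : R -> R -> R[i]) : R[i] :=
  Rintegral (lebesgue_measure \x lebesgue_measure)%E (sphere_chart A)
    (fun p => complex.Re (f p.1 p.2) * sin p.2)
  +i*
  Rintegral (lebesgue_measure \x lebesgue_measure)%E (sphere_chart A)
    (fun p => complex.Im (f p.1 p.2) * sin p.2).

Definition admissible_source_cone (C : set 'R3[R]) : Prop :=
  [/\ closed C, is_cone C,
      exists2 K, strictly_convex_circular_cone K & C `<=` K,
      connected_exterior C &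
      exists2 m : int, -2 <= m <= 2 &
        sphere_integral (unit_sphere `&` C) (spherical_harmonic 2 m) != 0].

End SphericalHarmonics.

(* Main.v *)
Require Import Defs.
From mathcomp Require Import all_boot all_order all_algebra.
From mathcomp Require Import all_classical all_reals all_analysis.
From mathcomp Require Import measurable_realfun complex ring lra.
Import Order.TTheory GRing.Theory Num.Theory.
Import numFieldNormedType.Exports.
Local Open Scope classical_set_scope.
Local Open Scope ring_scope.

(** The index [m = 0] works: [Y_2^0] is real and equal to a positive constant
    times [(3 cos^2 theta - 1) / 2], and the magic angle is the angle at which
    this expression changes sign.  Hence [Y_2^0 >= 0] on the part of the sphere
    inside the circular cone of half-angle [magic_angle], with equality on its
    boundary only, so no cancellation can occur in the integral over the
    directions of [C].  It remains to see that these directions form a set that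
    is not negligible.

    Convexity makes this elementary.  If any three vectors of [C] were linearly
    dependent, [C] would lie in a plane through the origin ([coplanar]) and
    would be a null set ([vol3_plane]).  So [C] contains three independent
    vectors, hence the open cone that they span, and it has an interior point
    ([convex_cone_interior]).  Such a point can be taken off the plane where
    the second coordinate vanishes; its spherical coordinates are then interior
    to the parameter rectangle, a whole neighbourhood of them lies in the chart
    of [C] ([sphere_chart_nbhs]), and the integrand is strictly positive at that
    point because an interior point of [C] is not on the boundary of the
    circular cone ([interior_cone_magic]).  A bounded nonnegative function on a
    bounded set which is continuous and positive at an interior point has
    positive integral
    ([Rintegral_gt0_nbhs]).  The circular cone that contains [C] is the one
    given by the hypothesis. *)

(** * Integrals, product measures and null planes *)

(** The integral of a nonnegative function is the supremum of the integrals of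
    the simple functions below it, a quantity that is monotone in the function
    whether or not the function or the domain is measurable.  This spares any
    discussion of the measurability of [C], of its sections and of its chart. *)
Lemma le_integral_restrict {d} {T : measurableType d} {R : realType}
    (mu : {measure set T -> \bar R}) (D E : set T) (f g : T -> \bar R) :
  (forall x, D x -> (0 <= f x)%E) -> (forall x, E x -> (0 <= g x)%E) ->
  (forall x, ((f \_ D) x <= (g \_ E) x)%E) ->
  (\int[mu]_(x in D) f x <= \int[mu]_(x in E) g x)%E.
Proof.
move=> f0 g0 fg; rewrite !ge0_integralE//.
apply: ereal_sup_le => _ [h hf <-]; exists h => // x.
exact: le_trans (hf x) (fg x).
Qed.

(** Lebesgue measure is the restriction of an outer measure, whose value makes
    sense, and is monotone, on all sets. *)
Lemma le_lebesgue_measure {R : realType} (A B : set (measurableTypeR R)) :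
  A `<=` B -> (lebesgue_measure A <= lebesgue_measure B)%E.
Proof. by move=> AB; exact: le_mu_ext. Qed.

Lemma le_product_lebesgue {d} {T : measurableType d} {R : realType}
    (mu : {measure set T -> \bar R}) (A B : set (T * measurableTypeR R)) :
  A `<=` B ->
  ((mu \x @lebesgue_measure R) A <= (mu \x @lebesgue_measure R) B)%E.
Proof.
move=> AB; apply: le_integral_restrict => // x.
rewrite !patch_setT /=; apply: le_lebesgue_measure => y.
by rewrite /xsection /= !inE; exact: AB.
Qed.

Lemma product_lebesgue0 {d} {T : measurableType d} {R : realType}
    (mu : {measure set T -> \bar R}) (A : set (T * measurableTypeR R))
    (h : T -> R) :
  (forall x y, A (x, y) -> y = h x) -> (mu \x @lebesgue_measure R)%E A = 0%E.
Proof.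
move=> Ah; apply: integral0_eq => x _ /=; apply/eqP.
rewrite eq_le measure_ge0 andbT.
rewrite -(lebesgue_measure_set1 (h x)); apply: le_lebesgue_measure => y.
by rewrite /xsection /= inE => /Ah.
Qed.

(** A plane that is not vertical is the graph of a function of the first two
    coordinates; a vertical one is the product of a line of the horizontal
    plane, for which the same alternative arises one dimension lower, with the
    vertical axis. *)
Lemma vol3_plane {R : realType} (C : set 'R3[R]) (n : 'R3[R]) :
  n != 0 -> (forall x, C x -> dot n x = 0) -> vol3 C = 0%E.
Proof.
case: n => -[n1 n2] n3 n0 Cn.
rewrite /vol3; have [n30|n30] := eqVneq n3 0; last first.
  apply: (product_lebesgue0 (lebesgue_measure \x lebesgue_measure)%E C
    (fun x => - (n1 * x.1 + n2 * x.2) / n3)).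
  move=> [x1 x2] x3 /Cn; rewrite /dot /= => /eqP.
  rewrite addrC addr_eq0 => /eqP e.
  by rewrite -e mulrAC mulfV// mul1r.
pose L : set (measurableTypeR R * measurableTypeR R) :=
  [set x | n1 * x.1 + n2 * x.2 = 0].
have mL : measurable L.
  have mf : measurable_fun [set: measurableTypeR R * measurableTypeR R]
      (fun x => (n1 * x.1 + n2 * x.2 : measurableTypeR R)).
    apply: measurable_funD; apply: measurable_funM => //.
  rewrite -[L]setTI; have := mf measurableT [set 0] (measurable_set1 0).
  by congr measurable.
have L0 : (@lebesgue_measure R \x @lebesgue_measure R)%E L = 0%E.
  have [n20|n20] := eqVneq n2 0.
    have n10 : n1 != 0 by apply: contra_neq n0 => ->; rewrite n20 n30.
    have -> : L = [set 0] `*` setT.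
      apply/seteqP; split=> [[a b]|[a b] []] /=.
        rewrite /L /= n20 mul0r addr0 => /eqP; rewrite mulf_eq0 (negPf n10) /=.
        by move/eqP.
      by rewrite /L /= n20 => ->; rewrite mulr0 mul0r addr0.
    rewrite product_measure1E// [X in (X * _)%E](_ : _ = 0%E) ?mul0e//.
    exact: lebesgue_measure_set1.
  apply: (product_lebesgue0 (@lebesgue_measure R) L
    (fun x => - (n1 * x) / n2)) => a b.
  rewrite /L /= => /eqP; rewrite addrC addr_eq0 => /eqP e.
  by rewrite -e mulrAC mulfV// mul1r.
apply/eqP; rewrite eq_le measure_ge0 andbT.
apply: le_trans (le_product_lebesgue (lebesgue_measure \x lebesgue_measure)%E
  C (L `*` setT) _) _.
  by move=> -[[a b] c] /Cn; rewrite /dot /= n30 mul0r addr0.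
by rewrite product_measure1E// [X in (X * _)%E](_ : _ = 0%E) ?mul0e.
Qed.

(** A real-valued integral is nonzero only if the extended one is both nonzero
    and finite: the integrand is compared from below with a positive constant
    on a small square around [p], and from above with a constant on the box
    that contains the domain. *)
Lemma Rintegral_gt0_nbhs {R : realType}
    (D : set (measurableTypeR R * measurableTypeR R)) (f : R * R -> R)
    (a b c d M : R) (p : R * R) :
  D `<=` `[a, b] `*` `[c, d] -> (forall q, D q -> 0 <= f q <= M) ->
  nbhs p D -> {for p, continuous f} -> 0 < f p ->
  0 < Rintegral (@lebesgue_measure R \x @lebesgue_measure R)%E D f.
Proof.
move=> Dbox f0M nD cf fp0.
have [e e0 eD] : exists2 e : R, 0 < e &
    forall q, ball p e q -> D q /\ f p / 2 < f q.
  have : nbhs p (D `&` [set q | f p / 2 < f q]).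
    by apply: filterI => //; apply: (cvgr_gt _ cf); lra.
  by move=> /nbhs_ballP[e e0 He]; exists e.
pose B : set (measurableTypeR R * measurableTypeR R) :=
  ball p.1 e `*` ball p.2 e.
have mB : measurable B by apply: measurableX; exact: measurable_ball.
pose K : set (measurableTypeR R * measurableTypeR R) := `[a, b] `*` `[c, d].
have mK : measurable K by apply: measurableX; exact: measurable_itv.
apply: fine_gt0; apply/andP; split.
  apply: (@lt_le_trans _ _ (\int[lebesgue_measure \x lebesgue_measure]_(x in B)
    (f p / 2)%:E)%E).
    rewrite integral_cst//.
    rewrite [X in (_ * X)%E](_ : _ = (lebesgue_measure (ball p.1 e) *
      lebesgue_measure (ball p.2 e))%E); last first.
      by apply: product_measure1E; exact: measurable_ball.
    rewrite !lebesgue_measure_ball ?ltW// -!EFinM lte_fin.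
    by rewrite !mulr_gt0 ?pmulrn_lgt0//; lra.
  apply: le_integral_restrict => [x _|x /f0M/andP[]|x].
  - by rewrite lee_fin; lra.
  - by rewrite lee_fin.
  - rewrite /patch; case: ifPn => [/[!inE] Bx|_]; last first.
      by case: ifPn => // /[!inE] /f0M/andP[]; rewrite lee_fin.
    have [Dx /ltW fx] := eD x Bx.
    by rewrite mem_set// lee_fin.
apply: (@le_lt_trans _ _ (\int[lebesgue_measure \x lebesgue_measure]_(x in K)
  `|M|%:E)%E).
  apply: le_integral_restrict => [x /f0M/andP[]//|x _|x]; rewrite ?lee_fin//.
  rewrite /patch; case: ifPn => [/[!inE] Dx|_]; last first.
    by case: ifPn => //; rewrite lee_fin.
  rewrite (mem_set (Dbox _ Dx)) lee_fin.
  by have /andP[_ /le_trans] := f0M _ Dx; apply; exact: ler_norm.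
rewrite integral_cst// [X in (_ * X)%E](_ : _ = (lebesgue_measure `[a, b] *
  lebesgue_measure `[c, d])%E); last first.
  by apply: product_measure1E; exact: measurable_itv.
rewrite !lebesgue_measure_itv /=.
by do 2 case: ifP => _; rewrite -?EFinD ?mule0 ?mul0e -?EFinM ?ltry.
Qed.

(** * Convex cones of nonzero volume have interior points *)

Definition cross {R : realType} (u v : 'R3[R]) : 'R3[R] :=
  (u.1.2 * v.2 - u.2 * v.1.2, u.2 * v.1.1 - u.1.1 * v.2,
   u.1.1 * v.1.2 - u.1.2 * v.1.1).

(** Cramer's rule for the basis [u, v, w], whose determinant is
    [dot (cross u v) w]; the coefficients are linear, hence continuous, in [x]. *)
Lemma cross_cramer {R : realType} (u v w x : 'R3[R]) :
  dot (cross u v) w *: x = dot (cross v w) x *: u + dot (cross w u) x *: v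
    + dot (cross u v) x *: w.
Proof.
case: u v w x => -[u1 u2] u3 [[v1 v2] v3] [[w1 w2] w3] [[x1 x2] x3].
have lin3 (a b c : R) (x y z : R) :
  a *: x + b *: y + c *: z = a * x + b * y + c * z by [].
by congr (_, _, _); rewrite /dot /cross /= lin3 /GRing.scale /=; ring.
Qed.

Lemma dot_cross_rot {R : realType} (u v w : 'R3[R]) :
  dot (cross u v) w = dot (cross v w) u.
Proof. by rewrite /dot /cross /=; ring. Qed.

Lemma continuous_dot {R : realType} (n : 'R3[R]) : continuous (dot n).
Proof.
move=> x; rewrite /dot.
have c1 : (fun y : 'R3[R] => y.1.1) y @[y --> x] --> x.1.1.
  by apply: (cvg_comp fst fst); exact: cvg_fst.
have c2 : (fun y : 'R3[R] => y.1.2) y @[y --> x] --> x.1.2.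
  by apply: (cvg_comp fst snd); [exact: cvg_fst|exact: cvg_snd].
apply: cvgD; first apply: cvgD; apply: cvgM; try exact: cvg_cst.
- exact: c1.
- exact: c2.
- exact: cvg_snd.
Qed.

(** Case analysis on the rank of [C]: a normal vector is the cross product of
    two independent vectors of [C] when they exist, a vector orthogonal to a
    nonzero element of [C] when all its elements are parallel, and arbitrary
    when [C] is reduced to the origin. *)
Lemma coplanar {R : realType} (C : set 'R3[R]) :
  (forall u v w, C u -> C v -> C w -> dot (cross u v) w = 0) ->
  exists2 n : 'R3[R], n != 0 & forall x, C x -> dot n x = 0.
Proof.
move=> det0.
have [[u [v [Cu Cv uv0]]]|par] :=
  pselect (exists u v, [/\ C u, C v & cross u v != 0]).
  by exists (cross u v) => // x Cx; exact: det0.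
have {}par u x : C u -> C x -> cross u x = 0.
  by move=> Cu Cx; apply/eqP/negPn/negP => ux0; apply: par; exists u, x.
have e3_neq0 : ((0, 0, 1) : 'R3[R]) != 0.
  by apply/eqP => -[/eqP]; rewrite oner_eq0.
have [[u Cu u0]|C0] := pselect (exists2 u, C u & u != 0); last first.
  exists ((0, 0, 1) : 'R3[R]) => // x Cx.
  have -> : x = 0 by apply/eqP/negPn/negP => x0; apply: C0; exists x.
  by rewrite /dot /= !mulr0 !addr0.
have [n n0 nu] : exists2 n, n != 0 & exists e, n = cross e u.
  (* A nonzero vector is not parallel to both the third and the first axis. *)
  have [e0|e0] := eqVneq (cross (0, 0, 1) u) 0; last first.
    by exists (cross (0, 0, 1) u) => //; exists (0, 0, 1).
  exists (cross (1, 0, 0) u); last by exists (1, 0, 0).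
  apply: contraNneq u0 => f0; apply/eqP.
  case: u e0 f0 {Cu} => -[u1 u2] u3; rewrite /cross /=.
  move=> [e1 e2 _] [_ f1 _].
  by congr (_, _, _); lra.
exists n => // x Cx; case: nu => e ->.
by rewrite dot_cross_rot (par _ _ Cu Cx) /dot /= !mul0r !addr0.
Qed.

Lemma convex_cone_addr {R : realType} (C : set 'R3[R]) :
  is_cone C -> convex_set C -> forall x y, C x -> C y -> C (x + y).
Proof.
move=> coneC convC x y Cx Cy.
(* The sum is twice the midpoint. *)
have h0 : 0 <= (2^-1 : R) by lra.
have h1 : (2^-1 : R) <= 1 by lra.
have := convC x y (Itv01 h0 h1) (mem_set Cx) (mem_set Cy).
rewrite inE => /(coneC 2 _ (ler0n R 2)).
congr C; transitivity (2 *: (2^-1 *: x + (1 - 2^-1) *: y)) => //.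
have e : 2 * (1 - 2^-1) = 1 :> R by lra.
by rewrite scalerDr !scalerA e mulfV ?pnatr_eq0// !scale1r.
Qed.

(** At [u + v + w] the three coordinates in the basis [u, v, w] are equal to 1,
    so they stay positive nearby, and the points with positive coordinates
    belong to the cone. *)
Lemma convex_cone_interior {R : realType} (C : set 'R3[R]) u v w :
  is_cone C -> convex_set C -> C u -> C v -> C w -> dot (cross u v) w != 0 ->
  C^° (u + v + w).
Proof.
move=> coneC convC Cu Cv Cw d0; set d := dot (cross u v) w in d0.
have combC a b c : 0 < a -> 0 < b -> 0 < c -> C (a *: u + b *: v + c *: w).
  move=> /ltW a0 /ltW b0 /ltW c0.
  have Cuv := convex_cone_addr C coneC convC _ _ (coneC _ _ a0 Cu)
    (coneC _ _ b0 Cv).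
  exact: (convex_cone_addr C coneC convC _ _ Cuv (coneC _ _ c0 Cw)).
pose coef n x := dot n x / d.
have coef_near n p : 0 < coef n p -> \forall x \near p, 0 < coef n x.
  move=> h; have c : coef n x @[x --> p] --> coef n p.
    by apply: cvgM; [exact: continuous_dot|exact: cvg_cst].
  exact: (cvgr_gt _ c).
have dotE n : dot n (u + v + w) = dot n u + dot n v + dot n w.
  by rewrite /dot /=; ring.
have cross_l (x y : 'R3[R]) : dot (cross x y) x = 0.
  by rewrite /dot /cross /=; ring.
have cross_r (x y : 'R3[R]) : dot (cross x y) y = 0.
  by rewrite /dot /cross /=; ring.
have a1 : 0 < coef (cross v w) (u + v + w).
  by rewrite /coef dotE cross_l cross_r -dot_cross_rot !addr0 mulfV.
have b1 : 0 < coef (cross w u) (u + v + w).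
  by rewrite /coef dotE cross_l cross_r -2!dot_cross_rot addr0 add0r mulfV.
have c1 : 0 < coef (cross u v) (u + v + w).
  by rewrite /coef dotE cross_l cross_r !add0r mulfV.
near=> x.
have -> : x = coef (cross v w) x *: u + coef (cross w u) x *: v
    + coef (cross u v) x *: w.
  rewrite -[LHS](scalerK d0) cross_cramer !scalerDr !scalerA.
  by rewrite /coef ![d^-1 * _]mulrC.
apply: combC.
- by near: x; exact: coef_near.
- by near: x; exact: coef_near.
- by near: x; exact: coef_near.
Unshelve. all: by end_near.
Qed.

(** * The circular cone of the magic angle *)

Lemma interior_box {R : realType} (A : set 'R3[R]) x : A^° x ->
  exists2 e : R, 0 < e & forall y, `|x.1.1 - y.1.1| < e ->
    `|x.1.2 - y.1.2| < e -> `|x.2 - y.2| < e -> A y.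
Proof.
move=> /nbhs_ballP[e e0 eA]; exists e => // y y1 y2 y3.
by apply: eA; split => //; split.
Qed.

(** The plane where the second coordinate vanishes contains both the polar axis
    and the half-plane where the longitude jumps from [2 pi] to 0; away from it the spherical
    coordinates are interior to the parameter rectangle. *)
Lemma interior_off_plane {R : realType} (A : set 'R3[R]) x :
  A^° x -> exists2 y, A^° y & y.1.2 != 0.
Proof.
move=> Ax; have [x0|x0] := eqVneq x.1.2 0; last by exists x.
have : (A^°)^° x by apply: nbhs_interior.
move=> /interior_box[e e0 eA]; exists (x.1.1, e / 2, x.2) => /=; last lra.
by apply: eA; rewrite /= ?subrr ?normr0// x0 sub0r normrN gtr0_norm; lra.
Qed.

Lemma tan_magic_angle {R : realType} :
  0 < tan (@magic_angle R) /\ tan (@magic_angle R) ^+ 2 = 2.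
Proof.
have [/andP[m0 m1] cE] := @magic_angleP R.
have c0 : 0 < cos (@magic_angle R) by rewrite cE invr_gt0 sqrtr_gt0.
split.
  rewrite /tan divr_gt0// sin_gt0_pi// m0 /=.
  by apply: lt_le_trans m1 _; have := @pi_gt0 R; lra.
have := cos2_tan2 (lt0r_neq0 c0).
by rewrite cE exprVn invrK sqr_sqrtr//; lra.
Qed.

(** The tangent of the magic angle is the square root of 2, so the cone
    condition can be squared. *)
Lemma cone_magicP {R : realType} (x : 'R3[R]) :
  cone_gamma magic_angle x ->
  0 <= x.2 /\ x.1.1 ^+ 2 + x.1.2 ^+ 2 <= 2 * x.2 ^+ 2.
Proof.
have [t0 t2] := @tan_magic_angle R.
rewrite /cone_gamma /= => h; have x0 : 0 <= x.2.
  by rewrite -(pmulr_lge0 _ t0) (le_trans _ h)// sqrtr_ge0.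
split=> //; rewrite -t2 mulrC -exprMn -ler_sqrt ?sqr_ge0// sqrtr_sqr.
by rewrite ger0_norm// mulr_ge0// ltW.
Qed.

(** Lowering the point slightly along the axis keeps it in the cone, which
    makes the inequality at the original height strict. *)
Lemma interior_cone_magic {R : realType} (A : set 'R3[R]) x :
  A `<=` cone_gamma magic_angle -> A^° x ->
  x.1.1 ^+ 2 + x.1.2 ^+ 2 < 2 * x.2 ^+ 2.
Proof.
move=> Asub /interior_box[e e0 eA].
have [|/= y0 yle] := cone_magicP (x.1, x.2 - e / 2).
  apply/Asub/eA; rewrite /= ?subrr ?normr0//.
  by rewrite opprB addrC subrK gtr0_norm; lra.
by apply: le_lt_trans yle _; nra.
Qed.

(** * Spherical coordinates *)

(** Upper half-plane version, used both for the colatitude, where the distance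
    to the axis is positive, and for the longitude. *)
Lemma polar_upper {R : realType} (a b : R) : 0 < b ->
  exists r t, [/\ 0 < r, 0 < t < pi, a = r * cos t & b = r * sin t].
Proof.
move=> b0; pose r := Num.sqrt (a ^+ 2 + b ^+ 2).
have r2 : r ^+ 2 = a ^+ 2 + b ^+ 2 by rewrite sqr_sqrtr// addr_ge0 ?sqr_ge0.
have r0 : 0 < r by rewrite sqrtr_gt0; nra.
have c1 : -1 < a / r by rewrite ltr_pdivlMr//; nra.
have c2 : a / r < 1 by rewrite ltr_pdivrMr//; nra.
exists r, (acos (a / r)); split => //.
- by rewrite acos_gt0 ?acos_ltpi ?c1 ?c2 ?ltW.
- by rewrite acosK ?in_itv /= ?ltW// mulrC divfK ?gt_eqF.
- rewrite sin_acos ?ltW//= -[X in X * _]ger0_norm ?ltW// -sqrtr_sqr.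
  rewrite -sqrtrM ?sqr_ge0// mulrBr mulr1 -exprMn mulrC divfK ?gt_eqF// r2.
  by rewrite addrAC subrr add0r sqrtr_sqr gtr0_norm.
Qed.

Lemma polar {R : realType} (a b : R) : b != 0 ->
  exists r t, [/\ 0 < r, 0 < t < 2 * pi, a = r * cos t & b = r * sin t].
Proof.
rewrite neq_lt => /orP[b0|b0].
  have nb0 : 0 < - b by lra.
  have [r [t [r0 /andP[t0 t1] aE bE]]] := polar_upper a (- b) nb0.
  (* The angle is that of the reflected point, negated and moved to [0, 2 pi]. *)
  exists r, (- t + pi *+ 2); split => //; first by rewrite mulr2n; lra.
    by rewrite cosD2pi cosN.
  by rewrite sinD2pi sinN mulrN -bE opprK.
have [r [t [r0 /andP[t0 t1] aE bE]]] := polar_upper a b b0.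
by exists r, t; split => //; lra.
Qed.

Lemma spherical_coordP {R : realType} (x : 'R3[R]) : x.1.2 != 0 ->
  exists r phi theta, [/\ 0 < r, 0 < phi < 2 * pi, 0 < theta < pi &
    x = r *: spherical_coord phi theta].
Proof.
case: x => -[x1 x2] x3 /= x20.
have [s [phi [s0 phi0 x1E x2E]]] := polar x1 x2 x20.
have [r [theta [r0 theta0 x3E sE]]] := polar_upper x3 s s0.
exists r, phi, theta; split => //; rewrite /spherical_coord.
congr (_, _, _) => //=; rewrite /GRing.scale/=.
- by rewrite mulrA -sE.
- by rewrite mulrA -sE.
Qed.

Lemma continuous_spherical_coord {R : realType} :
  continuous (fun p : R * R => spherical_coord p.1 p.2).
Proof.
have cos1 (p : R * R) : cos q.1 @[q --> p] --> cos p.1.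
  by apply: (cvg_comp fst cos); [exact: cvg_fst|exact: continuous_cos].
have sin1 (p : R * R) : sin q.1 @[q --> p] --> sin p.1.
  by apply: (cvg_comp fst sin); [exact: cvg_fst|exact: continuous_sin].
have cos2 (p : R * R) : cos q.2 @[q --> p] --> cos p.2.
  by apply: (cvg_comp snd cos); [exact: cvg_snd|exact: continuous_cos].
have sin2 (p : R * R) : sin q.2 @[q --> p] --> sin p.2.
  by apply: (cvg_comp snd sin); [exact: cvg_snd|exact: continuous_sin].
move=> p; apply: (cvg_pair (G := nbhs _) (H := nbhs _)) => /=; last exact: cos2.
apply: (cvg_pair (G := nbhs _) (H := nbhs _)) => /=.
  by apply: cvgM; [exact: sin2|exact: cos1].
by apply: cvgM; [exact: sin2|exact: sin1].
Qed.

Lemma spherical_coord_unit {R : realType} (phi theta : R) :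
  unit_sphere (spherical_coord phi theta).
Proof.
rewrite /unit_sphere /= /enorm -[RHS]sqrtr1; congr Num.sqrt.
have := cos2Dsin2 phi; have := cos2Dsin2 theta; rewrite /dot /=.
move: (cos phi) (sin phi) (cos theta) (sin theta) => a b c d h1 h2.
have -> : d * a * (d * a) + d * b * (d * b) + c * c
  = d ^+ 2 * (a ^+ 2 + b ^+ 2) + c ^+ 2 by ring.
by rewrite h2 mulr1 addrC.
Qed.

(** The cone property brings the interior point, found at distance [r] from the
    origin, back to the unit sphere. *)
Lemma sphere_chart_nbhs {R : realType} (C : set 'R3[R]) (r phi theta : R) :
  is_cone C -> 0 < r -> 0 < phi < 2 * pi -> 0 < theta < pi ->
  C^° (r *: spherical_coord phi theta) ->
  nbhs ((phi, theta) : R * R) (sphere_chart (unit_sphere `&` C)).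
Proof.
move=> coneC r0 /andP[p0 p1] /andP[t0 t1] Cx.
have c : (r *: spherical_coord q.1 q.2) @[q --> (phi, theta)] -->
    r *: spherical_coord phi theta.
  exact: (cvgZl_tmp (@continuous_spherical_coord R (phi, theta))).
have n1 : fst @ nbhs (phi, theta) --> phi by exact: cvg_fst.
have n2 : snd @ nbhs (phi, theta) --> theta by exact: cvg_snd.
near=> q; split; last split.
- by apply/andP; split; apply: ltW; near: q;
    [exact: (cvgr_gt _ n1)|exact: (cvgr_lt _ n1)].
- by apply/andP; split; apply: ltW; near: q;
    [exact: (cvgr_gt _ n2)|exact: (cvgr_lt _ n2)].
- exact: spherical_coord_unit.
rewrite -[spherical_coord _ _](scalerK (lt0r_neq0 r0)).
apply: coneC; first by rewrite invr_ge0 ltW.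
by near: q; exact: (c _ Cx).
Unshelve. all: by end_near.
Qed.

(** * The zonal harmonic of degree 2 *)

Lemma legendre2 {R : realType} (x : R) :
  (legendre 2).[x] = (3 * x ^+ 2 - 1) / 2.
Proof.
have -> : legendre 2 = 8^-1 *: (12 *: 'X^2 - 4%:P) :> {poly R}.
  rewrite /legendre; congr (_ *: _).
  have -> : ('X^2 - 1) ^+ 2 = 'X^4 - 2 *: 'X^2 + 1%:P :> {poly R}.
    by rewrite -mul_polyC; ring.
  rewrite derivnD derivnB derivnZ derivnC !derivnXn.
  rewrite -!mul_polyC !polyC_natr /= (_ : 4 ^_ 2 = 12)%N// (_ : 2 ^_ 2 = 2)%N//.
  by rewrite expr0; ring.
rewrite !(hornerD, hornerN, hornerZ, hornerC, hornerXn).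
by field.
Qed.

Lemma spherical_harmonic20 {R : realType} (phi theta : R) :
  complex.Re (spherical_harmonic 2 0 phi theta) =
  Num.sqrt (5 / (4 * pi)) * ((3 * cos theta ^+ 2 - 1) / 2).
Proof.
rewrite /spherical_harmonic /assoc_legendre /assoc_legendre_nat /expi /=.
rewrite legendre2 mul0r cos0 expr0z !expr0 !mul1r mul0r mulr1 subr0 mulr0.
by rewrite subr0 divff ?pnatr_eq0// mulr1.
Qed.

(** * The integral over the directions of the cone *)

(** On the chart of [C] one has [sin^2 theta <= 2 cos^2 theta], which says that
    the harmonic is nonnegative, strictly so in the direction of an interior
    point. *)
Lemma sphere_integral20_neq0 {R : realType} (C : set 'R3[R]) x :
  is_cone C -> C `<=` cone_gamma magic_angle -> C^° x ->
  sphere_integral (unit_sphere `&` C) (spherical_harmonic 2 0) != 0.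
Proof.
move=> coneC Csub /interior_off_plane[{}x Cx x2].
have [r [phi [theta [r0 phi01 theta01 xE]]]] := spherical_coordP x x2.
pose k : R := Num.sqrt (5 / (4 * pi)).
have k0 : 0 < k by rewrite sqrtr_gt0 divr_gt0// mulr_gt0// pi_gt0.
pose f (q : R * R) : R := k * ((3 * cos q.2 ^+ 2 - 1) / 2) * sin q.2.
suff f_gt0 : 0 < Rintegral (@lebesgue_measure R \x @lebesgue_measure R)%E
    (sphere_chart (unit_sphere `&` C)) f.
  apply: contraTneq f_gt0 => /(congr1 (@complex.Re R)) /= I0.
  rewrite (_ : Rintegral _ _ _ = 0) ?ltxx// -[RHS]I0; apply: eq_Rintegral => q _.
  by rewrite /f -(spherical_harmonic20 q.1).
have sph2 s t u : (s * cos t) ^+ 2 + (s * sin t) ^+ 2 <= 2 * u ^+ 2 ->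
  s ^+ 2 <= 2 * u ^+ 2 :> R.
  by rewrite !exprMn -mulrDr cos2Dsin2 mulr1.
apply: (@Rintegral_gt0_nbhs _ _ _ 0 (2 * pi) 0 pi k (phi, theta)).
- by move=> [p t] [/= p01 t01 _]; split; rewrite /= in_itv.
- move=> [p t] [/= _ t01 [_ /Csub/cone_magicP[/= _ /sph2]]] => c2.
  have s0 := sin_ge0_pi t01.
  have s1 := sin_le1 t.
  have c1 := cos2Dsin2 t.
  rewrite /f /=.
  have h0 : 0 <= (3 * cos t ^+ 2 - 1) / 2 by lra.
  have h1 : (3 * cos t ^+ 2 - 1) / 2 <= 1 by nra.
  move: ((3 * cos t ^+ 2 - 1) / 2) h0 h1 => y y0 y1.
  rewrite -mulrA mulr_ge0 ?mulr_ge0 ?(ltW k0)//=.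
  by rewrite ler_piMr ?(ltW k0)// mulr_ile1.
- by apply: (sphere_chart_nbhs C r) => //; rewrite -xE.
- apply: cvgM; last first.
    by apply: (cvg_comp snd sin); [exact: cvg_snd|exact: continuous_sin].
  apply: cvgM; first exact: cvg_cst.
  apply: cvgM; last exact: cvg_cst.
  apply: cvgB; last exact: cvg_cst.
  apply: cvgM; first exact: cvg_cst.
  by apply: cvgM; apply: (cvg_comp snd cos);
    [exact: cvg_snd|exact: continuous_cos|exact: cvg_snd|exact: continuous_cos].
- have := interior_cone_magic _ _ Csub Cx; rewrite xE /= => lt2.
  have {}lt2 : sin theta ^+ 2 < 2 * cos theta ^+ 2.
    move: lt2; rewrite /GRing.scale /= !exprMn -!mulrDr cos2Dsin2 mulr1.
    by rewrite [ltRHS]mulrCA ltr_pM2l// exprn_gt0.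
  rewrite /f /= mulr_gt0 ?sin_gt0_pi// mulr_gt0//.
  have := cos2Dsin2 theta; lra.
Qed.

Theorem proposition3p6 (R : realType) (C : set 'R3[R])
  (C_closed : closed C)
  (C_strictly_convex : strictly_convex_cone C)
  (C_nonnull : vol3 C <> 0%E)
  (C_exterior : connected_exterior C)
  (C_sub : C `<=` cone_gamma (@magic_angle R)) :
  admissible_source_cone C.
Proof.
have [coneC convC _] := C_strictly_convex.
have [x Cx] : exists x, C^° x.
  apply: contrapT => intC0; apply: C_nonnull.
  have [|n n0 nC] := coplanar C; last exact: vol3_plane n0 nC.
  move=> u v w Cu Cv Cw; apply/eqP/negPn/negP => d0; apply: intC0.
  by exists (u + v + w); exact: convex_cone_interior.
split => //.
- exists (cone_gamma magic_angle) => //.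
  exists (0, 0, 1), magic_angle; split.
  + by rewrite /enorm /dot /= !mulr0 !add0r mulr1 sqrtr1.
  + exact: magic_angleP.1.
  + by rewrite circular_cone_e3.
- by exists 0 => //; exact: sphere_integral20_neq0 Cx.
Qed.
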